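(* Let $m\ge 3$, $X=\mathbb{F}_{2^m}\setminus\{0,1\}$, and let $W_2,W_3$ be as in the context. Then the triple $(X,W_2,W_3)$ is a $\mathrm{GDD}(2^m-2,2,3)$ with balance parameter $\lambda_3=1$.
   Context: $\mathbb{F}_{2^m}$ is the finite field with $2^m$ elements, with zero $0$ and unity $1$; all sums are in $\mathbb{F}_{2^m}$. For each integer $k\ge 2$, $W_k=\{B\subset X : |B|=k,\ \sum_{i\in B} i=1,\ \text{and } \binom{B}{\ell}\cap W_\ell=\emptyset \text{ for all } 2\le \ell\le k-3\}$ (recursive definition; $\binom{B}{\ell}$ is the set of $\ell$-subsets of $B$; the last condition is vacuous for $k\le 4$). A group divisible design $\mathrm{GDD}(v,n,k)$ is a triple $(X,\mathcal{G},\mathcal{B})$ where $X$ is a $v$-set, $\mathcal{G}$ is a collection of $n$-subsets of $X$ (groups) and $\mathcal{B}$ is a collection of $k$-subsets of $X$ (blocks), such that (i) $\mathcal{G}$ is a partition of $X$; (ii) no two elements of a block lie together in a common group; (iii) every pair of distinct elements of $X$ from different groups occurs together in exactly $\lambda$ blocks; $\lambda$ is called the balance parameter. *)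

(* Defs.v *)
From mathcomp Require Import all_boot all_order all_algebra.
Set Implicit Arguments.
Unset Strict Implicit.
Unset Printing Implicit Defensive.
Import GRing.Theory.
Local Open Scope ring_scope.

Section Blocks.
Variable F : finFieldType.

Definition Xset : {set F} := ~: [set 0; 1].

Definition ksubsets (B : {set F}) (l : nat) : {set {set F}} :=
  [set C : {set F} | C \subset B & #|C| == l].

(* One step of the recursion: the family of level k computed from a family V
   of which only the levels l with 2 <= l <= k - 3 are used. *)
Definition Wstep (V : nat -> {set {set F}}) (k : nat) : {set {set F}} :=
  [set B : {set F} | [&& B \subset Xset, #|B| == k, \sum_(i in B) i == 1 &
     [forall l : 'I_k, (2 <= l)%N && (l + 3 <= k)%N ==>
        (ksubsets B l :&: V l == set0)]]].

(* The recursion is on a fuel n; any n > k gives the same set (W_rec_fuel),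
   and W satisfies the intended recursive characterization (in_W).
   The levels k < 2 are not meaningful and are never consulted. *)
Fixpoint W_rec (n k : nat) : {set {set F}} :=
  if n is n'.+1 then Wstep (W_rec n') k else set0.

Definition W (k : nat) : {set {set F}} := W_rec k.+1 k.

Lemma Wstep_ext (V1 V2 : nat -> {set {set F}}) k :
  (forall l, (l < k)%N -> V1 l = V2 l) -> Wstep V1 k = Wstep V2 k.
Proof.
move=> eqV; apply/setP=> B; rewrite !inE; do 3![congr (_ && _)].
by apply: eq_forallb => l; rewrite eqV.
Qed.

Lemma W_rec_fuel n1 n2 k : (k < n1)%N -> (k < n2)%N -> W_rec n1 k = W_rec n2 k.
Proof.
elim: n1 n2 k => [//|n1 IH] [//|n2] k lt1 lt2 /=.
by apply: Wstep_ext => l ltlk; apply: IH; apply: leq_trans ltlk _.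
Qed.

Lemma W_unfold k : W k = Wstep W k.
Proof. by apply: Wstep_ext => l ltlk; apply: W_rec_fuel. Qed.

Lemma in_W k (B : {set F}) :
  reflect [/\ B \subset Xset, #|B| = k, \sum_(i in B) i = 1 &
             forall l, (2 <= l)%N -> (l + 3 <= k)%N ->
               ksubsets B l :&: W l = set0]
          (B \in W k).
Proof.
rewrite W_unfold inE; apply: (iffP and4P).
  move=> [sB /eqP cB /eqP s1 /forallP H]; split=> // l l2 lk.
  have ltlk : (l < k)%N by apply: leq_trans lk; rewrite -addn1 leq_add2l.
  by have := H (Ordinal ltlk); rewrite /= l2 lk => /eqP.
move=> [sB /eqP cB /eqP s1 H]; split=> //; apply/forallP => l.
by apply/implyP => /andP[l2 lk]; apply/eqP/H.
Qed.

End Blocks.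

Record is_GDD (T : finType) (v n k lambda : nat)
    (X : {set T}) (G B : {set {set T}}) : Prop := IsGDD {
  gdd_card_points : #|X| = v;
  gdd_groups : forall g, g \in G -> g \subset X /\ #|g| = n;
  gdd_blocks : forall b, b \in B -> b \subset X /\ #|b| = k;
  gdd_partition : partition G X;
  gdd_transverse : forall b g x y, b \in B -> g \in G ->
    x \in b -> y \in b -> x != y -> ~ (x \in g /\ y \in g);
  gdd_balance : forall x y g h, x != y -> g \in G -> h \in G -> g != h ->
    x \in g -> y \in h ->
    #|[set b in B | (x \in b) && (y \in b)]| = lambda
}.

(* Main.v *)
Require Import Defs.
From mathcomp Require Import all_boot all_order all_algebra all_field.
Set Implicit Arguments.
Unset Strict Implicit.
Unset Printing Implicit Defensive.
Import GRing.Theory.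

(** In characteristic 2 the groups are the orbits {x, x + 1} of translation by
    1, and the third point of a block through x and y can only be x + y + 1.
    That point lies outside {0, 1, x, y} exactly when y differs from x and
    x + 1, that is, when x and y are in different groups. *)

Section PcharTwo.
Local Open Scope ring_scope.
Variable F : finFieldType.
Hypothesis F2 : 2%N \in [pchar F].

Lemma addr_eq_pchar2 (x y z : F) : (x + y == z) = (y == x + z).
Proof. by rewrite -(inj_eq (addrI x)) addrA addrr_pchar2 // add0r. Qed.

Lemma in_Xset (x : F) : (x \in Xset F) = (x != 0) && (x != 1).
Proof. by rewrite !inE negb_or. Qed.

(** Translation by [1] swaps [0] and [1], so it preserves their complement. *)
Lemma Xset_add1 (x : F) : (x + 1 \in Xset F) = (x \in Xset F).
Proof.
by rewrite !in_Xset addrC !addr_eq_pchar2 addr0 addrr_pchar2 // andbC.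
Qed.

Lemma neq_add1 (x : F) : x != x + 1.
Proof. by rewrite eq_sym addr_eq_pchar2 addrr_pchar2 // oner_neq0. Qed.

Lemma pair_in_W2 (x : F) : x \in Xset F -> [set x; x + 1] \in W F 2.
Proof.
move=> Xx; apply/in_W; split.
- by rewrite subUset !sub1set Xset_add1 Xx.
- by rewrite cards2 neq_add1.
- by rewrite big_setU1 ?in_set1 ?neq_add1 //= big_set1 addrA addrr_pchar2 // add0r.
- by move=> l l2; rewrite addn3.
Qed.

(** Removing [x] leaves a single point, which the sum condition forces to be [x + 1]. Hence any one
    point determines its group. *)
Lemma W2_eq (g : {set F}) (x : F) :
  g \in W F 2 -> x \in g -> g = [set x; x + 1].
Proof.
case/in_W=> _ card_g sum_g _ gx.
have /cards1P[y Dy] : #|g :\ x| == 1%N.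
  by move: card_g; rewrite (cardsD1 x) gx add1n => -[->].
move: sum_g; rewrite (big_setD1 x) //= Dy big_set1 => /eqP.
by rewrite addr_eq_pchar2 => /eqP <-; rewrite -Dy setD1K.
Qed.

(** Uniqueness half of the balance condition: once two points are removed, the sum condition fixes
    the remaining one. *)
Lemma W3_eq (b : {set F}) (x y : F) :
  b \in W F 3 -> x \in b -> y \in b -> x != y -> b = [set x; y; x + y + 1].
Proof.
case/in_W=> _ card_b sum_b _ bx b_y nxy.
have b'y : y \in b :\ x by rewrite !inE eq_sym nxy.
have /cards1P[z Dz] : #|b :\ x :\ y| == 1%N.
  by move: card_b; rewrite (cardsD1 x) bx (cardsD1 y) b'y !add1n => -[->].
move: sum_b; rewrite (big_setD1 x) //= (big_setD1 y) //= Dz big_set1 addrA.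
move=> /eqP; rewrite addr_eq_pchar2 => /eqP <-.
by rewrite -Dz -setUA setD1K // setD1K.
Qed.

(** Existence half of the balance condition. *)
Lemma triple_in_W3 (x y : F) : x \in Xset F -> y \in Xset F ->
  x != y -> y != x + 1 -> [set x; y; x + y + 1] \in W F 3.
Proof.
move=> Xx Xy nxy ny; have := Xx; have := Xy; rewrite !in_Xset.
move=> /andP[y0 y1] /andP[x0 x1].
(* After cancellation this inequality is [y != 1]; likewise [zy] is [x != 1]. *)
have zx : x + y + 1 != x.
  by rewrite -addrA addr_eq_pchar2 addrr_pchar2 // addrC addr_eq_pchar2 addr0.
have zy : x + y + 1 != y.
  rewrite [x + y]addrC -addrA addr_eq_pchar2 addrr_pchar2 //.
  by rewrite addrC addr_eq_pchar2 addr0.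
have z_notin : x + y + 1 \notin [set x; y] by rewrite !inE negb_or zx.
apply/in_W; split.
(* By translation invariance it suffices that [x + y] avoids [0] and [1], which is [y != x] and
   [y != x + 1]. *)
- rewrite !subUset !sub1set Xx Xy Xset_add1 in_Xset !addr_eq_pchar2 addr0.
  by rewrite eq_sym nxy ny.
- by rewrite setUC cardsU1 z_notin cards2 nxy.
- rewrite setUC big_setU1 //= big_setU1 ?in_set1 //= big_set1 addrAC.
  by rewrite addrr_pchar2 // add0r.
(* The recursive condition is vacuous: no [l] satisfies both [2 <= l] and [l + 3 <= 3]. *)
- by move=> [|[|l]] //= _; rewrite addn3.
Qed.

Lemma W2_partition : partition (W F 2) (Xset F).
Proof.
apply/and3P; split.
- apply/eqP/setP=> x; apply/bigcupP/idP => [[g Wg]|Xx].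
    by case/in_W: Wg => /subsetP sgX _ _ _ /sgX.
  by exists [set x; x + 1]; rewrite ?pair_in_W2 // set21.
- apply/trivIsetP=> g h Wg Wh; apply: contraR => /pred0Pn[x /andP[/= gx hx]].
  by rewrite (W2_eq Wg gx) (W2_eq Wh hx).
- by apply/negP=> /in_W[_]; rewrite cards0.
Qed.

Lemma W3_transverse (b g : {set F}) (x y : F) : b \in W F 3 -> g \in W F 2 ->
  x \in b -> y \in b -> x != y -> ~ (x \in g /\ y \in g).
Proof.
move=> Wb Wg bx b_y nxy [gx]; rewrite (W2_eq Wg gx) !inE eq_sym (negPf nxy) /=.
(* With [y = x + 1], the third point [x + y + 1] of the block would be [0], which is not in
   [Xset F]. *)
move=> /eqP Dy; have b0 : 0 \in b.
  rewrite (W3_eq Wb bx b_y nxy) !inE Dy addrA addrr_pchar2 // add0r.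
  by rewrite addrr_pchar2 // eqxx orbT.
by case/in_W: Wb => /subsetP/(_ _ b0); rewrite in_Xset eqxx.
Qed.

Lemma W3_balance (x y : F) : x \in Xset F -> y \in Xset F -> x != y ->
  y != x + 1 -> #|[set b in W F 3 | (x \in b) && (y \in b)]| = 1%N.
Proof.
move=> Xx Xy nxy ny; apply/eqP/cards1P; exists [set x; y; x + y + 1].
apply/setP=> b; rewrite inE in_set1; apply/and3P/eqP => [[Wb bx b_y]|->].
  exact: W3_eq.
by rewrite triple_in_W3 // !inE !eqxx orbT.
Qed.

End PcharTwo.

Theorem theorem3p6 (F : finFieldType) (m : nat) (hm : 3 <= m)
  (hF : #|F| = 2 ^ m) :
  is_GDD (2 ^ m - 2) 2 3 1 (Xset F) (W F 2) (W F 3).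
Proof.
have F2 : 2 \in [pchar F]%R := card_finPcharP hF isT.
have subX k g : g \in W F k -> g \subset Xset F /\ #|g| = k by case/in_W.
split; [| exact: subX | exact: subX | exact: W2_partition
        | exact: W3_transverse |].
  by rewrite cardsCs setCK cards2 eq_sym oner_neq0 hF.
move=> x y g h nxy Wg Wh ngh gx hy.
have [/subsetP/(_ x gx) Xx _] := subX _ _ Wg.
have [/subsetP/(_ y hy) Xy _] := subX _ _ Wh.
(* If [y = x + 1], then [y] also lies in [g], so [g] and [h] are both the group of [y]. *)
apply: W3_balance => //; apply: contraNneq ngh => Dy.
have gy : y \in g by rewrite (W2_eq F2 Wg gx) Dy set22.
by rewrite (W2_eq F2 Wg gy) (W2_eq F2 Wh hy).
Qed.
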